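(* Let $G$ be a connected graph on $N$ vertices $V=\{1,\dots,N\}$ with fixed orthonormal Laplacian eigenbasis $\{\varphi_k\}_{k=0}^{N-1}$ and eigenvector matrix $\Phi$, and let $i\in\{1,\dots,N\}$. If $\varphi_k(i)\neq 0$ for all $k=1,\dots,N-1$, then the graph translation operator $T_i$ is invertible and its inverse is $$T_i^{-1}=\frac{1}{\sqrt N}\,\Phi\begin{pmatrix}\varphi_0^*(1)\,\varphi_0^*(i)^{-1} & \varphi_0^*(2)\,\varphi_0^*(i)^{-1} & \cdots & \varphi_0^*(N)\,\varphi_0^*(i)^{-1}\\ \vdots & \vdots & \cdots & \vdots\\ \varphi_{N-1}^*(1)\,\varphi_{N-1}^*(i)^{-1} & \varphi_{N-1}^*(2)\,\varphi_{N-1}^*(i)^{-1} & \cdots & \varphi_{N-1}^*(N)\,\varphi_{N-1}^*(i)^{-1}\end{pmatrix}.$$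
   Context: All graphs are finite, undirected, unweighted and simple (no loops, no multiple edges). The Laplacian of $G$ is $L=D-A$ ($D$ the diagonal degree matrix, $A$ the adjacency matrix), i.e. $Lf(x)=\sum_{y\sim x}(f(x)-f(y))$. Its eigenvalues are $0=\lambda_0\le\lambda_1\le\cdots\le\lambda_{N-1}$, and one fixes an orthonormal basis of (real- or complex-valued) eigenvectors $\varphi_0,\dots,\varphi_{N-1}$ with $L\varphi_k=\lambda_k\varphi_k$ and $\varphi_0\equiv 1/\sqrt N$; $\Phi$ is the $N\times N$ matrix with these as columns. The graph Fourier transform of $f:V\to\mathbb{C}$ is $\hat f(\lambda_k)=\langle f,\varphi_k\rangle=\sum_{n=1}^N f(n)\varphi_k^*(n)$, where $^*$ denotes complex conjugation and the value is indexed by $k$. For $i\in\{1,\dots,N\}$, the graph translation operator $T_i:\mathbb{C}^N\to\mathbb{C}^N$ is $(T_if)(n)=\sqrt N\sum_{k=0}^{N-1}\hat f(\lambda_k)\varphi_k^*(i)\varphi_k(n)$, identified with its matrix in the standard basis. *)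

(* Defs.v *)
From mathcomp Require Import all_boot all_order all_algebra.
From mathcomp Require Import reals.
From mathcomp Require Import complex.

Set Implicit Arguments.
Unset Strict Implicit.
Unset Printing Implicit Defensive.

Import Order.TTheory GRing.Theory Num.Theory.
Local Open Scope ring_scope.

Record sgraph (V : finType) := SGraph {
  adj :> rel V;
  adj_sym : symmetric adj;
  adj_irr : irreflexive adj }.

Definition connected_graph (V : finType) (G : sgraph V) : Prop :=
  forall x y : V, connect G x y.

Definition degree (V : finType) (G : sgraph V) (x : V) : nat :=
  #|[set y | G x y]|.

Section Matrices.
Variables (K : pzRingType) (N : nat) (G : sgraph 'I_N).

Definition degree_mx : 'M[K]_N := diag_mx (\row_x (degree G x)%:R).
Definition adjacency_mx : 'M[K]_N := \matrix_(x, y) (G x y)%:R.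
Definition laplacian_mx : 'M[K]_N := degree_mx - adjacency_mx.

Lemma laplacian_mxE (f : 'cV[K]_N) (x : 'I_N) :
  (laplacian_mx *m f) x 0 = \sum_(y | G x y) (f x 0 - f y 0).
Proof.
rewrite mulmxBl !mxE sumrB sumr_const; congr (_ - _).
  rewrite (bigD1 x) //= big1 ?addr0 => [|y /negPf nyx]; last first.
    by rewrite !mxE eq_sym nyx mulr0n mul0r.
  by rewrite !mxE eqxx mulr1n mulr_natl /degree cardsE.
rewrite [RHS]big_mkcond; apply: eq_bigr => y _; rewrite !mxE.
by case: (G x y); rewrite ?mul1r ?mul0r.
Qed.

End Matrices.

(* Signals V -> C are column vectors; phi k is the k-th basis vector, so
   phi_k(x) is phi k x 0. *)
Section Fourier.
Variables (C : numClosedFieldType) (N : nat).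
Implicit Types (f g : 'cV[C]_N) (phi : 'I_N -> 'cV[C]_N).

Definition inner f g : C := \sum_x f x 0 * (g x 0)^*.

Definition orthonormal phi : Prop :=
  forall j k : 'I_N, inner (phi j) (phi k) = (j == k)%:R.

Definition eigenvector_mx phi : 'M[C]_N := \matrix_(x, k) phi k x 0.

Definition graph_fourier phi f (k : 'I_N) : C := inner f (phi k).

Definition translation phi (i : 'I_N) f : 'cV[C]_N :=
  \col_x (sqrtC N%:R *
    \sum_k graph_fourier phi f k * (phi k i 0)^* * phi k x 0).

(* The matrix of [translation phi i] in the standard basis. *)
Definition translation_mx phi (i : 'I_N) : 'M[C]_N :=
  \matrix_(x, y) translation phi i (delta_mx y 0) x 0.

Lemma translation_mxE phi i f : translation_mx phi i *m f = translation phi i f.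
Proof.
apply/colP => x; rewrite !mxE.
under eq_bigr => y _ do rewrite !mxE -mulrA mulr_suml.
rewrite -mulr_sumr exchange_big /=; congr (_ * _); apply: eq_bigr => k _.
rewrite /graph_fourier /inner !mulr_suml; apply: eq_bigr => y _.
rewrite (bigD1 y) //= big1 ?addr0 => [|z /negPf nzy]; last first.
  by rewrite !mxE nzy mul0r.
by rewrite !mxE !eqxx mul1r mulrC !mulrA.
Qed.

End Fourier.

(* On n.+1 vertices: an orthonormal eigenbasis phi of the Laplacian, with real
   eigenvalues lam sorted in nondecreasing order (with multiplicity). *)
Record laplacian_eigenbasis (R : realType) (n : nat) (G : sgraph 'I_n.+1)
    (lam : 'I_n.+1 -> R) (phi : 'I_n.+1 -> 'cV[R[i]]_n.+1) : Prop := {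
  eigenvalue0 : lam ord0 = 0;
  eigenvalue_homo : {homo lam : j k / (j <= k)%N >-> j <= k};
  eigenbasis_orthonormal : orthonormal phi;
  eigenbasis_eigen : forall k, laplacian_mx _ G *m phi k = (lam k)%:C%C *: phi k;
  eigenbasis0 : phi ord0 = const_mx (sqrtC n.+1%:R)^-1 }.

(* Main.v *)
Require Import Defs.
From mathcomp Require Import all_boot all_order all_algebra.
From mathcomp Require Import reals.
From mathcomp Require Import complex.

Import Order.TTheory GRing.Theory Num.Theory.
Local Open Scope ring_scope.

(** In the orthonormal basis [phi], translation by [i] is a Fourier multiplier:
    it scales the [k]-th Fourier coefficient by [sqrt N * (phi k i)^*].  In matrix
    form [T_i = sqrt N *: (Phi *m D *m Phi^H)], where [D] is the diagonal matrix of
    the [(phi k i)^*] ([translation_mx_spectral]) and [Phi] is unitary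
    ([eigenvector_adjK], [eigenvector_mxK]).  When no [phi k i] vanishes, [T_i] is
    therefore inverted by inverting the multiplier, which gives
    [(sqrt N)^-1 *: (Phi *m D^-1 *m Phi^H)]; the entries of [D^-1 *m Phi^H] are
    the ratios [(phi k x)^* / (phi k i)^*] of the stated formula
    ([translation_mx_inv]).  For [k = 0] nonvanishing at [i] is
    automatic, [phi ord0] being a nonzero constant. *)

Definition eigenvector_adj {C : numClosedFieldType} {N : nat}
    (phi : 'I_N -> 'cV[C]_N) : 'M[C]_N :=
  \matrix_(k, x) (phi k x 0)^*.

Lemma eigenvector_adjK (C : numClosedFieldType) (N : nat)
    (phi : 'I_N -> 'cV[C]_N) :
  Defs.orthonormal phi -> eigenvector_adj phi *m eigenvector_mx phi = 1%:M.
Proof.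
move=> phi_on; apply/matrixP => j k; rewrite !mxE eq_sym -phi_on.
by apply: eq_bigr => x _; rewrite !mxE mulrC.
Qed.

(** A left inverse of a square matrix is a right inverse: this is where the
    number of basis vectors being the dimension is used. *)
Lemma eigenvector_mxK (C : numClosedFieldType) (N : nat)
    (phi : 'I_N -> 'cV[C]_N) :
  Defs.orthonormal phi -> eigenvector_mx phi *m eigenvector_adj phi = 1%:M.
Proof. by move=> phi_on; apply/mulmx1C/eigenvector_adjK. Qed.

(** The [k]-th Fourier coefficient of the indicator of [y] is [(phi k y)^*], so
    the columns of [T_i] are read off from the definition of translation. *)
Lemma translation_mx_spectral (C : numClosedFieldType) (N : nat)
    (phi : 'I_N -> 'cV[C]_N) (i : 'I_N) :
  translation_mx phi i =
    sqrtC N%:R *: (eigenvector_mx phi *m diag_mx (\row_k (phi k i 0)^*)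
                     *m eigenvector_adj phi).
Proof.
apply/matrixP => x y; rewrite !mxE; congr (_ * _).
apply: eq_bigr => k _; rewrite mul_mx_diag !mxE.
have -> : graph_fourier phi (delta_mx y 0) k = (phi k y 0)^*.
  rewrite /graph_fourier /inner (bigD1 y) //= big1 ?addr0 => [|z /negPf nzy].
    by rewrite mxE !eqxx mul1r.
  by rewrite mxE nzy mul0r.
by rewrite mulrC -mulrA [_^* * _]mulrC mulrA.
Qed.

Lemma translation_mx_inv (C : numClosedFieldType) (N : nat)
    (phi : 'I_N -> 'cV[C]_N) (i : 'I_N) :
    Defs.orthonormal phi -> (forall k, phi k i 0 != 0) ->
  translation_mx phi i *m
    ((sqrtC N%:R)^-1 *:
      (eigenvector_mx phi *m
         \matrix_(k, x) ((phi k x 0)^* * ((phi k i 0)^*)^-1))) = 1%:M.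
Proof.
move=> phi_on phi_i.
have sqrtN_neq0 : sqrtC N%:R != 0 :> C.
  by rewrite sqrtC_eq0 pnatr_eq0 -lt0n (leq_trans _ (ltn_ord i)).
rewrite translation_mx_spectral -scalemxAl -scalemxAr scalerA mulfV // scale1r.
rewrite -!mulmxA (mulmxA (eigenvector_adj phi)) eigenvector_adjK // mul1mx.
rewrite -[RHS](eigenvector_mxK _ _ _ phi_on); congr (_ *m _).
apply/matrixP => k x; rewrite mul_diag_mx !mxE.
by rewrite mulrCA mulfV ?mulr1 // conjC_eq0.
Qed.

Theorem corollary2p6 (R : realType) (n : nat) (G : sgraph 'I_n.+1)
    (lam : 'I_n.+1 -> R) (phi : 'I_n.+1 -> 'cV[R[i]]_n.+1) (i : 'I_n.+1)
    (Gconn : connected_graph G)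
    (phiP : laplacian_eigenbasis G lam phi)
    (phi_i : forall k : 'I_n.+1, k != ord0 -> phi k i 0 != 0) :
  translation_mx phi i \in unitmx /\
  invmx (translation_mx phi i) =
    (sqrtC n.+1%:R)^-1 *:
      (eigenvector_mx phi *m
         \matrix_(k, x) ((phi k x 0)^* * ((phi k i 0)^*)^-1)).
Proof.
have phi_i_neq0 k : phi k i 0 != 0.
  have [->|/phi_i //] := eqVneq k ord0.
  by rewrite (eigenbasis0 phiP) mxE invr_eq0 sqrtC_eq0 pnatr_eq0.
have TV := translation_mx_inv _ _ phi i (eigenbasis_orthonormal phiP) phi_i_neq0.
have [T_unit _] := mulmx1_unit TV; split=> //.
by rewrite -[RHS](mulKmx T_unit) TV mulmx1.
Qed.
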